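(* For each $0<\alpha<1$ and each integer $d\ge 2$, the set $[0,1)\setminus\mathscr{E}_{\alpha,d}$ is of the first Baire category.
   Context: Write $\mathbf{e}(x)=\exp(2\pi i x)$. For $x\in[0,1)$ and $N\in\mathbb{N}$ let $\sigma_d(x;N)=\sum_{n=1}^{N}\mathbf{e}(xn^d)$, and for $0<\alpha<1$ let $$\mathscr{E}_{\alpha,d}=\{x\in[0,1):\ |\sigma_d(x;N)|\ge N^{\alpha}\text{ for infinitely many }N\in\mathbb{N}\}.$$ A subset of $\mathbb{R}$ is nowhere dense if its closure has empty interior, and is of the first Baire category if it is a countable union of nowhere dense sets. *)

(* Defs.v *)
From HB Require Import structures.
From mathcomp Require Import all_boot all_order all_algebra.
From mathcomp Require Import complex.
From mathcomp Require Import all_classical all_reals all_analysis.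

Set Implicit Arguments.
Unset Strict Implicit.
Unset Printing Implicit Defensive.

Import Order.TTheory GRing.Theory Num.Theory.
Import numFieldNormedType.Exports.

Local Open Scope classical_set_scope.
Local Open Scope ring_scope.
Local Open Scope complex_scope.

(* The complex exponential, through Euler's formula. *)
Definition cexp (R : realType) (z : R[i]) : R[i] :=
  (expR (complex.Re z))%:C * (cos (complex.Im z) +i* sin (complex.Im z)).

Definition ee (R : realType) (x : R) : R[i] := cexp (2 * (pi : R)%:C * 'i * x%:C).

Definition weyl_sum (R : realType) (d : nat) (x : R) (N : nat) : R[i] :=
  \sum_(1 <= n < N.+1) ee (x * n%:R ^+ d).

(* The order and the norm are those of R[i], so that [r%:C <= `|z|] is the
   inequality between the real number r and the modulus of z. *)
Definition large_sums (R : realType) (alpha : R) (d : nat) : set R :=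
  [set x | (x \in `[0, 1[) /\
    infinite_set [set N : nat | (0 < N)%N /\
      (N%:R `^ alpha)%:C <= `|weyl_sum d x N|]].

Definition nowhere_dense (T : topologicalType) (A : set T) : Prop :=
  interior (closure A) = set0.

(* Finite unions are covered, since the empty set is nowhere dense. *)
Definition first_category (T : topologicalType) (A : set T) : Prop :=
  exists F : nat -> set T,
    (forall n, nowhere_dense (F n)) /\ A = \bigcup_n F n.

(* Main.v *)
Require Import Defs.
From mathcomp Require Import all_boot all_order all_algebra ring lra zify.
From mathcomp Require Import complex.
From mathcomp Require Import all_classical all_reals all_analysis.

(** The exponential sums are of linear size at a dense set of rational points,
and this is stable enough to give a Baire category argument.

If x = a / q is a rational number in lowest terms, then
sigma_d (x; k q) = k S(q, a), where S(q, a) is the complete sum over the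
residues modulo q. So the sum grows linearly along the multiples of q as soon
as S(q, a) <> 0. For q = p ^ 2, with p a prime that does not divide d, the
complete sum can be computed: write n = u + v p with 0 <= u < p. Modulo p ^ 2,
n ^ d = u ^ d + d u ^ (d - 1) v p, so that summing over v gives a geometric
sum of p-th roots of unity. It vanishes unless p divides d u ^ (d - 1), that
is, unless u = 0, and the terms with u = 0 are all equal to 1. Hence
sigma_d (x; k p ^ 2) = k p exactly ([weyl_sum_rational]). The numerators
a = p b + 1 suffice: they are prime to p, and the points b / p + 1 / p ^ 2 are
dense when p ranges over the large primes and b over the integers
([weyl_rationals_dense]).

The complement of E in [0, 1) is the union over K of the sets of the x such that
|sigma_d (x; N)| < N ^ alpha for all N >= K. On the closure of such a set,
Re sigma_d (x; N) <= N ^ alpha for all N >= K, by continuity. If the closure had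
an interior point, it would contain one of the rational points above, where
Re sigma_d (x; N) = N / p for all multiples N of p ^ 2; this exceeds N ^ alpha
for N large, since alpha < 1. So each of these sets is nowhere dense. *)

Import Order.TTheory GRing.Theory Num.Theory.
Import numFieldNormedType.Exports.
Local Open Scope classical_set_scope.
Local Open Scope ring_scope.

(** * The character e(x) *)

Lemma eeE (R : realType) (x : R) :
  ee x = Complex (cos (2 * pi * x)) (sin (2 * pi * x)).
Proof.
have -> : ee x = cexp (Complex 0 (2 * pi * x)).
  congr cexp; rewrite -[Num.imaginary]/(Complex 0 1 : R[i]).
  apply/eqP; rewrite eq_complex /=; apply/andP; split; apply/eqP; ring.
by rewrite /cexp /= expR0 mul1r.
Qed.

Lemma eeD (R : realType) (x y : R) : ee (x + y) = ee x * ee y.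
Proof.
rewrite !eeE mulrDr cosD sinD; apply/eqP; rewrite eq_complex /= eqxx andTb.
by apply/eqP; ring.
Qed.

Lemma ee0 (R : realType) : ee (0 : R) = 1.
Proof. by rewrite eeE mulr0 cos0 sin0. Qed.

Lemma eeMn (R : realType) (x : R) (n : nat) : ee (x * n%:R) = ee x ^+ n.
Proof.
elim: n => [|n IHn]; first by rewrite mulr0 ee0 expr0.
by rewrite -natr1 mulrDr mulr1 eeD IHn exprSr.
Qed.

Lemma ee_nat (R : realType) (n : nat) : ee (n%:R : R) = 1.
Proof.
by rewrite -[n%:R]mul1r eeMn eeE mulr1 mulr_natl cos2pi sin2pi expr1n.
Qed.

Lemma ee_int (R : realType) (m : int) : ee (m%:~R : R) = 1.
Proof.
case: m => n; first exact: ee_nat.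
rewrite NegzE mulrNz; have := eeD R n.+1%:R (- n.+1%:R).
by rewrite subrr ee0 ee_nat mul1r => <-.
Qed.

(** With t = pi x, cos (2 t) = 1 - 2 sin t ^ 2, and sin t > 0 on ]0, pi[. *)
Lemma ee_neq1 (R : realType) (x : R) : 0 < x < 1 -> ee x != 1.
Proof.
move=> /andP[x0 x1]; rewrite eeE; apply/eqP => -[cos1 _].
have := @sin_gt0_pi R (pi * x).
have pi0 := pi_gt0 R.
rewrite mulr_gt0 //= gtr_pMr // => /(_ x1) s0.
have := cos2Dsin2 (pi * x); move: cos1.
by rewrite -mulrA mulr_natl cos_mulr2n; nra.
Qed.

Lemma ee_frac_neq1 (R : realType) (p c : nat) :
  (0 < p)%N -> ~~ (p %| c)%N -> ee (c%:R / p%:R : R) != 1.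
Proof.
move=> p0 pc; have p0' : (0 : R) < p%:R by rewrite ltr0n.
rewrite {1}(divn_eq c p) natrD natrM mulrDl
  (mulfK (lt0r_neq0 p0')) eeD ee_nat mul1r.
apply: ee_neq1; apply/andP; split; first by rewrite divr_gt0 // ltr0n lt0n.
by rewrite ltr_pdivrMr // mul1r ltr_nat ltn_mod.
Qed.

(** * Sums at the rational points (p b + 1) / p ^ 2 *)

Lemma expnD_mod_sqr (u w d : nat) : exists M : nat,
  ((u + w) ^ d.+1 = u ^ d.+1 + d.+1 * u ^ d * w + w ^ 2 * M)%N.
Proof.
elim: d => [|d [M IHd]]; first by exists 0%N; rewrite !expn1 expn0; lia.
exists (d.+1 * u ^ d + (u + w) * M)%N.
by rewrite expnS IHd !(expnS u); ring.
Qed.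

Lemma sum_geo_root1 (F : fieldType) (z : F) (n : nat) :
  z != 1 -> z ^+ n = 1 -> \sum_(i < n) z ^+ i = 0.
Proof.
move=> z1 zn; have := subrX1 z n; rewrite zn subrr => /esym/eqP.
by rewrite mulf_eq0 subr_eq0 (negPf z1) => /eqP.
Qed.

(** The numerator p b + 1 is congruent to 1 modulo p, hence does not appear in
the p-th root of unity that is raised to the power v. *)
Lemma ee_pow_residue (R : realType) (p : nat) (b : int) (d u v : nat) :
  (0 < p)%N ->
  let x : R := (p%:Z * b + 1)%:~R / p%:R ^+ 2 in
  ee (x * (u + v * p)%:R ^+ d.+1) =
  ee (x * u%:R ^+ d.+1) * ee ((d.+1 * u ^ d)%:R / p%:R : R) ^+ v.
Proof.
move=> p0 x; have p0' : p%:R != 0 :> R by rewrite pnatr_eq0 -lt0n.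
have [M eM] := expnD_mod_sqr u (v * p) d.
set c := (d.+1 * u ^ d)%N in eM *.
(* The first-order term c v (p b + 1) / p contributes c v / p and the integer
   b c v; the second-order term is an integer since w ^ 2 = v ^ 2 p ^ 2. *)
have -> : x * (u + v * p)%:R ^+ d.+1 = x * u%:R ^+ d.+1 + (c%:R / p%:R) * v%:R +
    (b * (c * v)%N%:Z + (p%:Z * b + 1) * (v ^ 2 * M)%N%:Z)%:~R.
  rewrite -natrX eM /x !(natrD, natrM, natrX, rmorphD, rmorphM) /=.
  by rewrite -!pmulrn !(natrM, natrX); field.
by rewrite !eeD ee_int mulr1 eeMn.
Qed.

(** Summing over v first makes the contribution of each residue u modulo p a
geometric sum, which only u = 0 survives: a prime p > d divides neither d nor
a power of 0 < u < p. The exponent is at least 2 so that u = 0 makes the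
first-order term d u ^ (d - 1) vanish. *)
Lemma weyl_sum_rational (R : realType) (p k d : nat) (b : int) :
  prime p -> (d.+2 < p)%N ->
  weyl_sum d.+2 ((p%:Z * b + 1)%:~R / p%:R ^+ 2 : R) (k * p ^ 2) = (k * p)%:R.
Proof.
move=> pp dp; have p0 := prime_gt0 pp.
have p0' : p%:R != 0 :> R by rewrite pnatr_eq0 -lt0n.
set x := _ / _; set N := (k * p ^ 2)%N.
pose f n := ee (x * n%:R ^+ d.+2).
have f0 : f 0%N = 1 by rewrite /f expr0n mulr0 ee0.
have fN : f N = 1.
  have -> : f N = ee (((p%:Z * b + 1) * (k * N ^ d.+1)%N%:Z)%:~R).
    congr ee; rewrite intrM -pmulrn /x [(k * N ^ _)%:R]natrM natrX
      [N%:R ^+ d.+2]exprS.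
    move: (N%:R ^+ d.+1) => w.
    have -> : N%:R = k%:R * p%:R ^+ 2 :> R by rewrite natrM natrX.
    by field.
  exact: ee_int.
(* Shifting the range 1 .. N to 0 .. N - 1 is harmless as f 0 = f N. *)
have -> : weyl_sum d.+2 x N = \sum_(0 <= n < N) f n.
  have : f 0%N + \sum_(1 <= n < N.+1) f n = \sum_(0 <= n < N) f n + f N.
    by rewrite -big_ltn // big_nat_recr.
  by rewrite f0 fN addrC => /addIr.
rewrite /N expnS expn1 mulnA big_nat_mul.
have block v : \sum_(v * p <= n < v.+1 * p) f n =
    \sum_(u < p) ee (x * u%:R ^+ d.+2) *
      ee ((d.+2 * u ^ d.+1)%:R / p%:R : R) ^+ v.
  rewrite -{1}[(v * p)%N]add0n big_addn mulSn addnK big_mkord.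
  by apply: eq_bigr => u _; rewrite /f ee_pow_residue.
under eq_bigr => v _ do rewrite block.
rewrite exchange_big /=.
under eq_bigr => u _ do rewrite -mulr_sumr big_mkord.
rewrite (bigD1 (Ordinal p0)) //= [X in _ + X]big1 => [|u u0]; last first.
  have root_kp : ee ((d.+2 * u ^ d.+1)%:R / p%:R : R) ^+ (k * p) = 1.
    by rewrite -eeMn [(k * p)%:R]natrM mulrCA divfK // -natrM ee_nat.
  rewrite sum_geo_root1 ?mulr0 //; apply: ee_frac_neq1 => //.
  rewrite Euclid_dvdM // Euclid_dvdX // negb_or andbT !gtnNdvd // lt0n.
  by apply: contraNneq u0 => u0; apply/eqP/val_inj.
rewrite addr0 expr0n mulr0 ee0 mul1r exp0n // muln0 mul0r ee0.
by under eq_bigr => v _ do rewrite expr1n; rewrite sumr_const card_ord.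
Qed.

(** Taking b = floor (p y) puts b / p + 1 / p ^ 2 within 1 / p + 1 / p ^ 2 of y,
and this is at most 2 / p. *)
Lemma weyl_rationals_dense (R : realType) (d : nat) (y e : R) : 0 < e ->
  exists p (b : int), [/\ prime p, (d < p)%N &
    `|y - (p%:Z * b + 1)%:~R / p%:R ^+ 2| < e].
Proof.
move=> e0.
have [p] := prime_above (maxn d (Num.trunc (2 / e))).
rewrite gtn_max => /andP[dp ep] pp.
exists p, (Num.floor (p%:R * y)); split => //.
have p1 : (1 : R) < p%:R by rewrite ltr1n prime_gt1.
have p2 : 2 / e < p%:R.
  by rewrite -truncn_lt_nat // divr_ge0 // ltW.
have /andP[] := floor_itv (p%:R * y).
rewrite !intrD intrM -pmulrn.
move: (_%:~R : R) => b; move: (p%:R : R) p1 p2 => P p1 p2 b1 b2.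
have P0 : 0 < P by lra.
have i1 : 0 < P^-1 < 1 by rewrite invr_gt0 P0 invf_lt1.
have -> : y - (P * b + 1) / P ^+ 2 = (P * y - b) * P^-1 - P^-1 * P^-1.
  by field; lra.
rewrite ltr_pdivrMr // mulrC -ltr_pdivrMr // in p2.
rewrite ltr_norml; move: i1 p2; move: P^-1 => i; nra.
Qed.

(** * The category argument *)

Lemma powR_lt_linear (R : realType) (alpha c : R) : alpha < 1 -> 0 < c ->
  \forall N \near \oo, N%:R `^ alpha < c * N%:R.
Proof.
move=> a1 c0; pose r := 1 - alpha; have r0 : 0 < r by rewrite subr_gt0.
(* The inequality says that N ^ r > 1 / c, where r = 1 - alpha. *)
near=> N.
have N0 : (0 : R) < N%:R by near: N; exists 1%N => // n /=; rewrite ltr0n.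
have big : c^-1 `^ r^-1 < N%:R.
  near: N; exists (Num.trunc (c^-1 `^ r^-1)).+1 => // n /= hn.
  by rewrite (lt_le_trans (truncnS_gt _)) // ler_nat.
have : c^-1 < N%:R `^ r.
  have {1}-> : c^-1 = (c^-1 `^ r^-1) `^ r.
    by rewrite -powRrM mulVf ?lt0r_neq0 // powRr1 // invr_ge0 ltW.
  by apply: gt0_ltr_powR => //; rewrite nnegrE ?powR_ge0 // ltW.
rewrite -(ltr_pM2l c0) mulfV ?lt0r_neq0 // => h.
have {2}-> : N%:R = N%:R `^ alpha * N%:R `^ r.
  by rewrite -powRD ?lt0r_neq0 ?implybT // /r addrC subrK powRr1 // ltW.
by rewrite mulrCA ltr_pMr // powR_gt0.
Unshelve. all: by end_near. Qed.

Lemma Re_weyl_sum (R : realType) (d N : nat) (x : R) :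
  complex.Re (weyl_sum d x N) =
  \sum_(1 <= n < N.+1) cos (2 * pi * (x * n%:R ^+ d)).
Proof.
by rewrite raddf_sum; apply: eq_bigr => n _; rewrite eeE.
Qed.

(** As Re z <= |z| and the sums at the rational points are real and positive,
the real part alone carries the argument, and continuity is only needed for a
finite sum of cosines. *)
Lemma closed_Re_weyl_sum_le (R : realType) (d N : nat) (c : R) :
  closed [set x | complex.Re (weyl_sum d x N) <= c].
Proof.
have cont : continuous (fun x : R => complex.Re (weyl_sum d x N)).
  under [X in continuous X]eq_fun => x do rewrite Re_weyl_sum.
  apply: continuous_big => [|n _ x]; first exact: add_continuous.
  apply: continuous_comp; last exact: continuous_cos.
  by apply: cvgM; [exact: cvg_cst|apply: cvgM; [exact: cvg_id|exact: cvg_cst]].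
exact: (@preimage_closed _ _ (fun x : R => complex.Re (weyl_sum d x N))
  [set y | y <= c] (in1W cont) (@closed_le R c)).
Qed.

Definition small_sums_from (R : realType) (alpha : R) (d K : nat) : set R :=
  [set x | (x \in `[0, 1[) /\ forall N, (K <= N)%N -> (0 < N)%N ->
    ~~ ((N%:R `^ alpha)%:C%C <= `|weyl_sum d x N|)].
Arguments small_sums_from {R}.

Lemma small_sums_fromE (R : realType) (alpha : R) (d : nat) :
  `[0, 1[ `\` large_sums alpha d = \bigcup_K small_sums_from alpha d K.
Proof.
apply/seteqP; split=> x /=.
  move=> [x01 nx].
  have /finite_seqP[s es] : finite_set [set N : nat | (0 < N)%N /\
      (N%:R `^ alpha)%:C%C <= `|weyl_sum d x N|].
    by apply: contrapT => inf; apply: nx.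
  exists (\max_(i <- s) i).+1 => //; split => // N KN N0; apply/negP => le.
  have Ns : N \in s.
    have : [set N : nat | (0 < N)%N /\
      (N%:R `^ alpha)%:C%C <= `|weyl_sum d x N|] N by [].
    by rewrite es.
  by have := @leq_bigmax_seq _ s xpredT id N Ns isT; rewrite leqNgt KN.
move=> [K _ [x01 small]]; split=> // -[_]; apply.
apply: (sub_finite_set _ (finite_II K)) => N /= [N0 le].
by rewrite ltnNge; apply/negP => KN; move: (small N KN N0); rewrite le.
Qed.

(** A ball inside the closure would contain a point (p b + 1) / p ^ 2, where
the sum of length N = k p ^ 2 is N / p, larger than N ^ alpha for k large. *)
Lemma nowhere_dense_small_sums_from (R : realType) (alpha : R) (d K : nat) :
  alpha < 1 -> nowhere_dense (small_sums_from alpha d.+2 K).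
Proof.
move=> a1; rewrite /nowhere_dense -subset0 => y /nbhs_ballP[e /= e0 yC].
have [p [b [pp dp]]] := @weyl_rationals_dense R d.+2 y e e0.
set x := _ / _ => yx.
have p0 := prime_gt0 pp; have p0' : (0 : R) < p%:R by rewrite ltr0n.
have clx : forall N, (K <= N)%N -> (0 < N)%N ->
    complex.Re (weyl_sum d.+2 x N) <= N%:R `^ alpha.
  move=> N KN N0.
  suff : closure (small_sums_from alpha d.+2 K) `<=`
      [set x | complex.Re (weyl_sum d.+2 x N) <= N%:R `^ alpha].
    by apply; apply: yC.
  rewrite [X in _ `<=` X](closure_id _).1; last exact: closed_Re_weyl_sum_le.
  apply: closure_subset => z [_ /(_ N KN N0)]; apply: contraNT.
  rewrite -ltNge => /ltW le /=; apply: le_trans (normc_ge_Re _).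
  by rewrite lecR (le_trans le) // ler_norm.
have [N0 _ big] := @powR_lt_linear R _ _ a1 (divr_gt0 ltr01 p0').
(* A length beyond both K and N0, as k p ^ 2 >= k. *)
pose k := (maxn K N0).+1.
have leN m : (m <= maxn K N0)%N -> (m <= k * p ^ 2)%N.
  by move=> h; rewrite (leq_trans (leqW h)) // leq_pmulr // expn_gt0 p0.
have := clx _ (leN _ (leq_maxl _ _)).
rewrite muln_gt0 expn_gt0 p0 => /(_ isT).
rewrite weyl_sum_rational // leNgt.
have := big _ (leN _ (leq_maxr _ _)).
have -> : 1 / p%:R * (k * p ^ 2)%:R = (k * p)%:R :> R.
  by rewrite !natrM; field; rewrite lt0r_neq0.
by rewrite raddfMn /= => ->.
Qed.

Theorem theorem1p6 (R : realType) (alpha : R) (d : nat) :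
  0 < alpha < 1 -> (2 <= d)%N ->
  first_category (`[0, 1[ `\` large_sums alpha d).
Proof.
move=> /andP[_ a1]; case: d => [|[|d]] // _.
exists (small_sums_from alpha d.+2); split; last exact: small_sums_fromE.
by move=> K; exact: nowhere_dense_small_sums_from.
Qed.
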